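(* Let $f_1(t),f_2(t),\dots,f_k(t)\in\mathbb{Z}[t^{\pm1}]$, let $M$ be the Alexander quandle $\mathbb{Z}[t^{\pm 1}]/(f_1(t),f_2(t),\dots,f_k(t))$, and let $a=\gcd(f_1(1),f_2(1),\dots,f_k(1))$. Then the following hold. (1) The connected component decomposition of $M$ is given by $$M=\bigsqcup_{i=0}^{a-1}\mathrm{Orb}(i),$$ where $$\mathrm{Orb}(i)=\{[g(t)]\mid g(t)\in\mathbb{Z}[t^{\pm1}],\ g(1)\equiv i \bmod a\}=\{[i+(1-t)g(t)+aj]\mid g(t)\in\mathbb{Z}[t^{\pm1}],\ j\in\mathbb{Z}\}.$$ (2) For any $j=0,1,\dots,a-1$, it follows that $$\mathrm{Orb}(j)\cong\mathbb{Z}[t^{\pm1}]/\big((f_1(t),f_2(t),\dots,f_k(t))+I\big),$$ where $\widetilde{f_i}(t)$ is defined by $f_i(t)=(1-t)\widetilde{f_i}(t)+f_i(1)$ for any $i=1,2,\dots,k$, and $$I=\Big\{\sum_{i=1}^k a_i\widetilde{f_i}(t)\ \Big|\ a_i\in\mathbb{Z}[t^{\pm1}],\ \sum_{i=1}^k a_if_i(1)=0\Big\}.$$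
   Context: A quandle is a non-empty set $X$ with a binary operation $*$ such that (i) $a*a=a$ for all $a$; (ii) for every $a\in X$ the map $S_a:X\to X$, $S_a(x)=x*a$, is a bijection; (iii) $(a*b)*c=(a*c)*(b*c)$ for all $a,b,c$. A quandle homomorphism is a map preserving $*$; an isomorphism is a bijective homomorphism, and $\cong$ denotes isomorphism of quandles. A subquandle is a non-empty subset that is itself a quandle under $*$. The inner automorphism group $\mathrm{Inn}(X)$ is the group of bijections of $X$ generated by $\{S_a\mid a\in X\}$; it acts on $X$. The orbits of this action are called the connected components of $X$ (they are subquandles), and $\mathrm{Orb}(x)$ denotes the orbit containing $x$. The connected component decomposition of $X$ is the expression of $X$ as the disjoint union of its connected components. For a $\mathbb{Z}[t^{\pm1}]$-module $M$, the Alexander quandle $M$ is the set $M$ with $a*b=ta+(1-t)b$. Here $(f_1(t),\dots,f_k(t))$ is the ideal of $\mathbb{Z}[t^{\pm1}]$ generated by the $f_i(t)$, $[g(t)]$ is the class of $g(t)$ in the quotient, and $\mathrm{Orb}(i)$ means $\mathrm{Orb}([i])$. The quotient in (2) is also regarded as an Alexander quandle.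
   Formalization: When a = 0 (all f_i(1) = 0) the range i = 0,…,a−1 is empty and (1) would fail, e.g. for k = 1, f_1 = 0; in that case the index set in (1) and (2) is taken to be all integers, one component for each. For a > 0 nothing is changed. *)

(* Defs.v *)
From HB Require Import structures.
From mathcomp Require Import all_boot all_order all_algebra.
From mathcomp Require Import ring_quotient generic_quotient.
From mathcomp Require Import boolp classical_sets.

Set Implicit Arguments.
Unset Strict Implicit.
Unset Printing Implicit Defensive.

Import Order.TTheory GRing.Theory Num.Theory.
Local Open Scope classical_set_scope.
Local Open Scope quotient_scope.
Local Open Scope ring_scope.

Declare Scope quandle_scope.
Delimit Scope quandle_scope with Qd.
Reserved Notation "x *q y" (at level 40, left associativity).

HB.mixin Record isQuandle (X : Type) := {
  quandle_op : X -> X -> X;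
  quandle_inhabited : inhabited X;
  quandle_idem : forall a, quandle_op a a = a;
  quandle_bij : forall a, bijective (fun x => quandle_op x a);
  quandle_dist : forall a b c,
    quandle_op (quandle_op a b) c = quandle_op (quandle_op a c) (quandle_op b c)
}.

#[short(type="quandleType")]
HB.structure Definition Quandle := {X of isQuandle X}.

Notation "x *q y" := (quandle_op x y) : quandle_scope.
Local Open Scope quandle_scope.

Definition quandle_hom (X Y : quandleType) (h : X -> Y) : Prop :=
  forall x y, h (x *q y) = h x *q h y.

Definition quandle_iso (X Y : quandleType) : Prop :=
  exists2 h : X -> Y, quandle_hom h & bijective h.

Definition quandle_S (X : quandleType) (a : X) : X -> X := fun x => x *q a.

(* The subgroup of the group of bijections of X generated by the S_a. *)
Inductive Inn (X : quandleType) : (X -> X) -> Prop :=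
| Inn_gen a : Inn (quandle_S a)
| Inn_id : Inn id
| Inn_comp s u : Inn s -> Inn u -> Inn (s \o u)
| Inn_inv s u : Inn s -> cancel s u -> cancel u s -> Inn u.

Definition Orb (X : quandleType) (x : X) : set X :=
  [set y | exists2 s, Inn s & s x = y].

Section Component.
Variables (X : quandleType) (x0 : X).
Implicit Types x y : X.

Lemma Inn_bij (s : X -> X) : Inn s -> bijective s.
Proof.
elim=> {s} [a||s u _ sP _ uP|s u _ _ sK uK].
- exact: quandle_bij.
- by exists id.
- exact: bij_comp.
- by exists s.
Qed.

Lemma Orb_refl : Orb x0 x0.
Proof. by exists id => //; exact: Inn_id. Qed.

Lemma Orb_op x y : Orb x0 x -> Orb x0 (x *q y).
Proof.
case=> s sP <-; exists (quandle_S y \o s) => //.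
by apply: Inn_comp => //; exact: Inn_gen.
Qed.

Lemma Orb_opV x y : Orb x0 (x *q y) -> Orb x0 x.
Proof.
case=> s sP sE; have [u uK Ku] := quandle_bij y.
exists (u \o s); last by rewrite /= sE uK.
by apply: Inn_comp => //; apply: (Inn_inv (Inn_gen y)).
Qed.

Definition component : Type := {x : X | Orb x0 x}.

Lemma component_inj (x y : component) : sval x = sval y -> x = y.
Proof. by case: x y => [x xP] [y yP] /= e; exact: eq_exist. Qed.

Definition component_op (x y : component) : component :=
  exist _ (sval x *q sval y) (Orb_op (sval y) (svalP x)).

Lemma component_inhabited : inhabited component.
Proof. exact: (inhabits (exist _ x0 Orb_refl)). Qed.

Lemma component_idem (x : component) : component_op x x = x.
Proof. by apply: component_inj; exact: quandle_idem. Qed.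

Lemma component_bij (a : component) :
  bijective (fun x : component => component_op x a).
Proof.
have [u uK Ku] := quandle_bij (sval a).
have uP (y : component) : Orb x0 (u (sval y)).
  by apply: (@Orb_opV _ (sval a)); rewrite Ku; exact: svalP.
exists (fun y : component => exist _ (u (sval y)) (uP y) : component) => y;
  apply: component_inj => /=.
- exact: uK.
- exact: Ku.
Qed.

Lemma component_dist (a b c : component) :
  component_op (component_op a b) c =
  component_op (component_op a c) (component_op b c).
Proof. by apply: component_inj; exact: quandle_dist. Qed.

HB.instance Definition _ := isQuandle.Build component
  component_inhabited component_idem component_bij component_dist.

End Component.

(* Z[t,t^-1] is the subring { p / t^n } of the field of fractions of Z[t]. *)
Definition is_laurent : {pred {fraction {poly int}}} := fun x =>
  `[< exists (p : {poly int}) (n : nat),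
        x = FracField.tofrac p / FracField.tofrac 'X ^+ n >].

Lemma tofracX_neq0 n : FracField.tofrac ('X : {poly int}) ^+ n != 0.
Proof. by rewrite expf_neq0 // tofrac_eq0 polyX_eq0. Qed.

Lemma tofrac_fracB (p q : {poly int}) m n :
  FracField.tofrac p / FracField.tofrac 'X ^+ m
    - FracField.tofrac q / FracField.tofrac 'X ^+ n =
  FracField.tofrac (p * 'X^n - q * 'X^m) / FracField.tofrac 'X ^+ (m + n).
Proof.
rewrite -[- (_ / _)]mulNr addf_div ?tofracX_neq0 //.
by rewrite rmorphB !rmorphM !rmorphXn exprD mulNr.
Qed.

Lemma is_laurent_subring : subring_closed is_laurent.
Proof.
split=> [|_ _ /asboolP[p [m ->]] /asboolP[q [n ->]]
         |_ _ /asboolP[p [m ->]] /asboolP[q [n ->]]]; apply/asboolP.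
- by exists 1, 0%N; rewrite rmorph1 divr1.
- exists (p * 'X^n - q * 'X^m), (m + n)%N.
  exact: tofrac_fracB.
- exists (p * q), (m + n)%N.
  by rewrite rmorphM exprD mulf_div.
Qed.

HB.instance Definition _ :=
  GRing.isSubringClosed.Build {fraction {poly int}} is_laurent
    is_laurent_subring.

Record laurent := Laurent {
  laurent_val : {fraction {poly int}};
  _ : laurent_val \in is_laurent
}.
HB.instance Definition _ := [isSub for laurent_val].
HB.instance Definition _ := [Choice of laurent by <:].
HB.instance Definition _ := [SubChoice_isSubComNzRing of laurent by <:].

Lemma laurent_frac_subproof (p : {poly int}) (n : nat) :
  FracField.tofrac p / FracField.tofrac 'X ^+ n \in is_laurent.
Proof. by apply/asboolP; exists p, n. Qed.

Definition laurent_frac (p : {poly int}) (n : nat) : laurent :=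
  Laurent (laurent_frac_subproof p n).

Lemma laurentP (g : laurent) :
  exists (p : {poly int}) (n : nat), g = laurent_frac p n.
Proof.
have /asboolP[p [n gE]] := valP g; exists p, n.
exact: val_inj.
Qed.

Definition tvar : laurent := laurent_frac 'X 0.
Definition tV : laurent := laurent_frac 1 1.

Lemma mul_tV_t : tV * tvar = 1.
Proof.
apply: val_inj; rewrite /= rmorph1 expr0 divr1 expr1 mul1r.
by rewrite mulVf // -[X in X != 0]expr1 tofracX_neq0.
Qed.

(* g(1): the value p(1) for any way of writing g = p / t^n, see eval1E. *)
Definition eval1 (g : laurent) : int := (sval (cid (laurentP g))).[1].

Lemma eval1E p n : eval1 (laurent_frac p n) = p.[1].
Proof.
rewrite /eval1; case: cid => q /= [m /(congr1 laurent_val)/= /eqP].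
rewrite eqr_div ?tofracX_neq0 // -!rmorphXn -!rmorphM tofrac_eq.
move=> /eqP/(congr1 (fun r => r.[1])).
by rewrite !hornerM !hornerXn !expr1n !mulr1.
Qed.

Lemma laurent_fracB p q m n : laurent_frac p m - laurent_frac q n =
  laurent_frac (p * 'X^n - q * 'X^m) (m + n).
Proof. by apply: val_inj; exact: tofrac_fracB. Qed.

Lemma laurent_fracM p q m n : laurent_frac p m * laurent_frac q n =
  laurent_frac (p * q) (m + n).
Proof. by apply: val_inj; rewrite /= rmorphM exprD mulf_div. Qed.

Lemma laurent_frac1 : laurent_frac 1 0 = 1.
Proof. by apply: val_inj; rewrite /= rmorph1 expr0 divr1. Qed.

Lemma eval1_zmod_morphism : zmod_morphism eval1.
Proof.
move=> g h; have [p [m ->]] := laurentP g; have [q [n ->]] := laurentP h.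
by rewrite laurent_fracB !eval1E hornerD hornerN !hornerM !hornerXn
   !expr1n !mulr1.
Qed.

Lemma eval1_monoid_morphism : monoid_morphism eval1.
Proof.
split=> [|g h]; first by rewrite -laurent_frac1 eval1E hornerE.
have [p [m ->]] := laurentP g; have [q [n ->]] := laurentP h.
by rewrite laurent_fracM !eval1E hornerM.
Qed.

HB.instance Definition _ :=
  GRing.isZmodMorphism.Build laurent int eval1 eval1_zmod_morphism.
HB.instance Definition _ :=
  GRing.isMonoidMorphism.Build laurent int eval1 eval1_monoid_morphism.

Lemma eval1_tvar : eval1 tvar = 1.
Proof. by rewrite eval1E hornerX. Qed.

(* ft is the family of the \tilde f_i. *)
Definition is_tilde k (f ft : 'I_k -> laurent) : Prop :=
  forall i, f i = (1 - tvar) * ft i + (eval1 (f i))%:~R.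

Lemma laurent_frac_int (z : int) : laurent_frac z%:P 0 = z%:~R.
Proof.
apply: val_inj; rewrite [RHS](rmorph_int (\val : laurent -> _)) /= expr0 divr1.
by rewrite -[z in LHS]intz !rmorph_int.
Qed.

Lemma is_tilde_exists k (f : 'I_k -> laurent) : exists ft, is_tilde f ft.
Proof.
suff H (g : laurent) : exists h, g = (1 - tvar) * h + (eval1 g)%:~R.
  by have [ft ftP] := choice (fun i => H (f i)); exists ft.
have [p [n ->]] := laurentP g; rewrite eval1E.
have /factor_theorem[q qE] : root (p - p.[1]%:P * 'X^n) 1.
  by rewrite /root !hornerE expr1n mulr1 subrr.
exists (laurent_frac (- q) n); apply/eqP; rewrite -subr_eq; apply/eqP.
rewrite -laurent_frac_int -laurent_frac1 !laurent_fracB laurent_fracM.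
rewrite !addn0 add0n expr0 !mulr1 qE; congr laurent_frac.
by rewrite mulrN -mulNr opprB mulrC polyC1.
Qed.

Lemma is_tilde_unique k (f ft ft' : 'I_k -> laurent) :
  is_tilde f ft -> is_tilde f ft' -> ft = ft'.
Proof.
move=> fP fP'; apply/funext => i.
have /addIr/(congr1 laurent_val)/= := etrans (esym (fP i)) (fP' i).
move/mulfI => H; apply: val_inj; apply: H.
rewrite expr0 divr1 subr_eq0 -(rmorph1 (@FracField.tofrac {poly int})).
by rewrite tofrac_eq; apply/eqP => /(congr1 (fun p => p.[0])) /eqP;
   rewrite !hornerE.
Qed.

(* The ideals of ring_quotient are proper; the ideals here may contain 1, and
   the quotient R/S is then the zero module. *)
HB.mixin Record isIdealMul (R : comNzRingType) (S : R -> bool) := {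
  ideal_mulP : forall a, {in S, forall u, a * u \in S}
}.

#[short(type="ideal")]
HB.structure Definition Ideal (R : comNzRingType) :=
  {S of GRing.ZmodClosed R S & isIdealMul R S}.

HB.factory Record isIdeal (R : comNzRingType) (S : R -> bool) := {
  ideal_closedP : 0 \in S /\ forall a, {in S &, forall u v, a * u + v \in S}
}.
HB.builders Context R S of isIdeal R S.
Lemma ideal_zmod_closed : zmod_closed S.
Proof.
have [S0 Slin] := ideal_closedP.
by split=> // u v uS vS; rewrite addrC -mulN1r Slin.
Qed.
Lemma ideal_mul_closed a : {in S, forall u, a * u \in S}.
Proof.
have [S0 Slin] := ideal_closedP.
by move=> u uS; rewrite -[_ * _]addr0 Slin.
Qed.
HB.instance Definition _ := GRing.isZmodClosed.Build R S ideal_zmod_closed.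
HB.instance Definition _ := isIdealMul.Build R S ideal_mul_closed.
HB.end.

Section QuotientModule.
Variables (R : comNzRingType) (S : ideal R).

Definition quotmod : Type := Quotient.quot S.
HB.instance Definition _ := GRing.Zmodule.on quotmod.

Definition qclass (x : R) : quotmod := \pi_(Quotient.quot S) x.

Definition quotmod_scale (a : R) (x : quotmod) : quotmod :=
  qclass (a * repr (x : Quotient.quot S)).

Lemma qclass_eq x y : (qclass x == qclass y) = (x - y \in S).
Proof. by rewrite Quotient.idealrBE. Qed.

Lemma qclass_repr (x : quotmod) : qclass (repr (x : Quotient.quot S)) = x.
Proof. exact: reprK. Qed.

Lemma qclass_zmod_morphism : zmod_morphism qclass.
Proof. by move=> x y; rewrite /qclass raddfB. Qed.

HB.instance Definition _ :=
  GRing.isZmodMorphism.Build R quotmod qclass qclass_zmod_morphism.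

Lemma qclass_scale a x : quotmod_scale a (qclass x) = qclass (a * x).
Proof.
apply/eqP; rewrite qclass_eq -mulrBr ideal_mulP // -qclass_eq.
by rewrite qclass_repr.
Qed.

Lemma quotmod_scaleA a b x :
  quotmod_scale a (quotmod_scale b x) = quotmod_scale (a * b) x.
Proof. by rewrite -(qclass_repr x) !qclass_scale mulrA. Qed.

Lemma quotmod_scale1 : left_id 1 quotmod_scale.
Proof. by move=> x; rewrite -(qclass_repr x) !qclass_scale mul1r. Qed.

Lemma quotmod_scaleDr : right_distributive quotmod_scale +%R.
Proof.
move=> a x y; rewrite -(qclass_repr x) -(qclass_repr y) -raddfD !qclass_scale.
by rewrite mulrDr raddfD.
Qed.

Lemma quotmod_scaleDl x : {morph quotmod_scale^~ x : a b / a + b}.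
Proof.
by move=> a b; rewrite -(qclass_repr x) !qclass_scale mulrDl raddfD.
Qed.

HB.instance Definition _ := GRing.Zmodule_isLmodule.Build R quotmod
  quotmod_scaleA quotmod_scale1 quotmod_scaleDr quotmod_scaleDl.

Lemma qclassM a x : qclass (a * x) = a *: qclass x.
Proof. by rewrite -qclass_scale. Qed.

End QuotientModule.
Arguments quotmod {R} S.
Arguments qclass {R} S x.

Section Ideals.
Variable R : comNzRingType.

Definition in_ideal_gen k (f : 'I_k -> R) : R -> bool := fun x =>
  `[< exists c : 'I_k -> R, x = \sum_i c i * f i >].

Lemma ideal_gen_closed k (f : 'I_k -> R) :
  0 \in in_ideal_gen f /\
  forall a, {in in_ideal_gen f &, forall u v, a * u + v \in in_ideal_gen f}.
Proof.
split=> [|a _ _ /asboolP[c ->] /asboolP[d ->]]; apply/asboolP.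
- by exists (fun=> 0); rewrite big1 // => i _; rewrite mul0r.
- exists (fun i => a * c i + d i); rewrite mulr_sumr -big_split /=.
  by apply: eq_bigr => i _; rewrite mulrDl mulrA.
Qed.

HB.instance Definition _ k (f : 'I_k -> R) :=
  isIdeal.Build R (in_ideal_gen f) (ideal_gen_closed f).

Definition ideal_gen k (f : 'I_k -> R) : ideal R :=
  Ideal.clone R (in_ideal_gen f) _.

Definition in_ideal_add (I J : ideal R) : R -> bool := fun x =>
  `[< exists y z, [/\ y \in I, z \in J & x = y + z] >].

Lemma ideal_add_closed (I J : ideal R) :
  0 \in in_ideal_add I J /\
  forall a, {in in_ideal_add I J &, forall u v, a * u + v \in in_ideal_add I J}.
Proof.
split=> [|a _ _ /asboolP[u [v [uI vJ ->]]] /asboolP[w [x [wI xJ ->]]]];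
  apply/asboolP.
- by exists 0, 0; rewrite !rpred0 addr0.
- exists (a * u + w), (a * v + x); rewrite !rpredD ?ideal_mulP //.
  by split=> //; rewrite mulrDr addrACA.
Qed.

HB.instance Definition _ (I J : ideal R) :=
  isIdeal.Build R (in_ideal_add I J) (ideal_add_closed I J).

Definition ideal_add (I J : ideal R) : ideal R :=
  Ideal.clone R (in_ideal_add I J) _.

End Ideals.

Section RelationIdeal.
Variables (k : nat) (f ft : 'I_k -> laurent).

Definition in_tilde_ideal : laurent -> bool := fun x =>
  `[< exists c : 'I_k -> laurent,
        \sum_i c i * (eval1 (f i))%:~R = 0 /\ x = \sum_i c i * ft i >].

Lemma tilde_ideal_closed : 0 \in in_tilde_ideal /\
  forall a, {in in_tilde_ideal &, forall u v, a * u + v \in in_tilde_ideal}.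
Proof.
split=> [|a _ _ /asboolP[c [c0 ->]] /asboolP[d [d0 ->]]]; apply/asboolP.
- by exists (fun=> 0); split; rewrite big1 // => i _; rewrite mul0r.
- exists (fun i => a * c i + d i); split.
  + transitivity (a * \sum_i c i * (eval1 (f i))%:~R +
      \sum_i d i * (eval1 (f i))%:~R); last by rewrite c0 d0 mulr0 addr0.
    rewrite mulr_sumr -big_split /=.
    by apply: eq_bigr => i _; rewrite mulrDl mulrA.
  + rewrite mulr_sumr -big_split /=.
    by apply: eq_bigr => i _; rewrite mulrDl mulrA.
Qed.

HB.instance Definition _ :=
  isIdeal.Build laurent in_tilde_ideal tilde_ideal_closed.

Definition tilde_ideal : ideal laurent := Ideal.clone laurent in_tilde_ideal _.

End RelationIdeal.

Definition alexander (M : lmodType laurent) : Type := M.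

Section Alexander.
Variable M : lmodType laurent.
Implicit Types x y z : M.

Definition alexander_op x y : M := tvar *: x + (1 - tvar) *: y.

Lemma alexander_inhabited : inhabited M.
Proof. exact: (inhabits 0). Qed.

Lemma alexander_idem x : alexander_op x x = x.
Proof. by rewrite /alexander_op -scalerDl addrC subrK scale1r. Qed.

Lemma alexander_bij y : bijective (fun x => alexander_op x y).
Proof.
exists (fun x => tV *: (x - (1 - tvar) *: y)) => x; rewrite /alexander_op.
- by rewrite addrK scalerA mul_tV_t scale1r.
- by rewrite scalerA mulrC mul_tV_t scale1r subrK.
Qed.

Lemma alexander_dist x y z : alexander_op (alexander_op x y) z =
  alexander_op (alexander_op x z) (alexander_op y z).
Proof.
rewrite /alexander_op !scalerDr !scalerA [RHS]addrACA.
rewrite (mulrC tvar (1 - tvar)); congr (_ + _).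
by rewrite -scalerDl -mulrDr [tvar + _]addrC subrK mulr1.
Qed.

HB.instance Definition _ := isQuandle.Build (alexander M)
  alexander_inhabited alexander_idem alexander_bij alexander_dist.

End Alexander.

Definition gcd_at1 k (f : 'I_k -> laurent) : nat :=
  \big[gcdn/0%N]_(i < k) `|eval1 (f i)|%N.

(* The representatives 0, ..., a-1 of Z/aZ.  If a = 0, i.e. if every f_i
   vanishes at 1, then Z/aZ = Z and there is one component for each integer. *)
Definition residues (a : nat) : set int :=
  [set i | a = 0%N \/ (0 <= i)%R /\ (i < a%:Z)%R].

(* Main.v *)
(** The inner maps of an Alexander quandle move every point by an element of
    [(1-t)M], and [S_(x+h) x = x + (1-t)h], so [Orb(x) = x + (1-t)M].  As every
    Laurent polynomial is congruent to its value at [1] modulo [1-t], membership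
    in an orbit becomes a congruence modulo the gcd of the [f_i(1)], by Bezout.
    For (2), [h |-> j + (1-t)h] maps Z[t,1/t] onto [Orb(j)], and
    [(1-t)h = \sum_i c_i f_i] with [c_i = c_i(1) + (1-t)d_i] forces
    [\sum_i c_i(1) f_i(1) = 0] and, cancelling [1-t],
    [h = \sum_i c_i(1) ft_i + \sum_i d_i f_i]. *)

Require Import Defs.
From mathcomp Require Import all_boot all_order all_algebra.
From mathcomp Require Import boolp classical_sets.
From mathcomp Require Import ring.

Set Implicit Arguments.
Unset Strict Implicit.
Unset Printing Implicit Defensive.

Import GRing.Theory.
Local Open Scope classical_set_scope.
Local Open Scope ring_scope.

(** Induction on [k] from the two-integer Bezout identity: the old coefficients are scaled by [v]
    and [u] is put in front. For [k = 0] the empty gcd and the empty sum are both 0. *)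
Lemma biggcdn_bezout k (n : 'I_k -> int) :
  exists c : 'I_k -> int,
    (\big[gcdn/0%N]_(i < k) `|n i|%N)%:Z = \sum_i c i * n i.
Proof.
elim: k n => [|k IHk] n; first by exists (fun=> 0); rewrite !big_ord0.
have [c cE] := IHk (fun i => n (lift ord0 i)).
have [u [v uvE]] := Bezoutz (n ord0)
  (\big[gcdn/0%N]_(i < k) `|n (lift ord0 i)|%N)%:Z.
exists (fun i => if unlift ord0 i is Some j then v * c j else u).
rewrite !big_ord_recl unlift_none; transitivity (u * n ord0 + v *
  (\big[gcdn/0%N]_(i < k) `|n (lift ord0 i)|%N)%:Z).
  by rewrite uvE.
rewrite cE mulr_sumr; congr (_ + _).
by apply: eq_bigr => i _; rewrite liftK mulrA.
Qed.

Lemma dvdz_biggcdn k (n : 'I_k -> int) i :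
  (((\big[gcdn/0%N]_(i < k) `|n i|%N)%:Z) %| n i)%Z.
Proof. by rewrite dvdzE /= (bigD1 i) //= dvdn_gcdl. Qed.

(** Since [i %% 0 = i], one equation covers both the finite case and [a = 0]. *)
Lemma residuesP (a : nat) (i : int) : residues a i <-> (i %% a)%Z = i.
Proof.
split=> [[->|[i0 ia]]|ia]; first by rewrite modz0.
  by rewrite modz_small // i0.
have [->|a0] := eqVneq a 0%N; [by left | right].
by rewrite -ia modz_ge0 // ltz_pmod // ltz_nat lt0n.
Qed.

Lemma eval1_int (z : int) : eval1 z%:~R = z.
Proof. by rewrite rmorph_int intz. Qed.

Lemma eval1_1subt : eval1 (1 - tvar) = 0.
Proof. by rewrite rmorphB rmorph1 /= eval1_tvar subrr. Qed.

Lemma eval1_decomp (g : laurent) : exists h, g = (1 - tvar) * h + (eval1 g)%:~R.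
Proof.
have [ft ftP] := is_tilde_exists (fun _ : 'I_1 => g).
by exists (ft ord0); exact: ftP.
Qed.

(** Follows from the uniqueness of the tilde family: [(1 - tvar) * x] vanishes at 1, so both [x] and
    [y] are its tilde. *)
Lemma mul_1subt_inj : injective ( *%R (1 - tvar)).
Proof.
move=> x y xy; pose h z (_ : 'I_1) : laurent := z.
pose g (_ : 'I_1) := (1 - tvar) * x.
have g1 : eval1 (g ord0) = 0 by rewrite rmorphM /= eval1_1subt mul0r.
have gx : is_tilde g (h x) by move=> i; rewrite g1 addr0.
have gy : is_tilde g (h y) by move=> i; rewrite g1 addr0 /g xy.
by have /(congr1 (@^~ ord0)) := is_tilde_unique gx gy.
Qed.

Section AlexanderOrbits.
Variable M : lmodType laurent.
Implicit Types x h : M.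

Lemma alexander_opE x h : alexander_op x (x + h) = x + (1 - tvar) *: h.
Proof.
by rewrite /alexander_op scalerDr addrA -scalerDl [tvar + _]addrC subrK scale1r.
Qed.

Lemma Inn_alexander_sub (s : alexander M -> alexander M) : Inn s ->
  forall x, exists h, s x = x + (1 - tvar) *: h :> M.
Proof.
elim=> {s} [b x||s u _ IHs _ IHu x|s u _ IHs _ uK x].
- exists ((b : M) - x).
  by rewrite -alexander_opE addrCA subrr addr0.
- by move=> x; exists 0; rewrite scaler0 addr0.
- have [h hE] := IHu x; have [h' h'E] := IHs (u x).
  by exists (h + h'); rewrite scalerDr addrA -hE -h'E.
(* The inverse moves [x] by the opposite of the displacement of [s] at [u x]. *)
- have [h hE] := IHs (u x); exists (- h).
  by rewrite -[in RHS](uK x) hE scalerN addrK.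
Qed.

Lemma Orb_alexander x :
  Orb (x : alexander M) = [set y | exists h, y = x + (1 - tvar) *: h].
Proof.
apply/seteqP; split=> y /=.
  by case=> s /Inn_alexander_sub/(_ x)[h hE] <-; exists h.
case=> h ->; exists (quandle_S (x + h : alexander M)); first exact: Inn_gen.
exact: alexander_opE.
Qed.

End AlexanderOrbits.

Lemma qclass_onto (I : ideal laurent) (x : quotmod I) :
  exists g, x = qclass I g.
Proof. by exists (repr x); rewrite qclass_repr. Qed.

Lemma Orb_qclassE (I : ideal laurent) (x : laurent) :
  Orb (qclass I x : alexander (quotmod I)) =
  [set qclass I (x + (1 - tvar) * h) | h in [set: laurent]].
Proof.
rewrite Orb_alexander; apply/seteqP; split=> y /=.
  by case=> z ->; have [h ->] := qclass_onto z; exists h => //; rewrite raddfD /= qclassM.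
by case=> h _ <-; exists (qclass I h); rewrite raddfD -qclassM.
Qed.

(** The hypothesis says that [J] is the ideal quotient of [I] by [1 - tvar], so [F] induces a
    bijection from the quotient by [J] onto the orbit. The isomorphism exhibited is its inverse. *)
Lemma component_quotmod_iso (I J : ideal laurent) (x : laurent) :
  (forall h, ((1 - tvar) * h \in I) = (h \in J)) ->
  quandle_iso (component (qclass I x : alexander (quotmod I)))
    (alexander (quotmod J)).
Proof.
move=> IJ; set X := component _.
pose F h := qclass I (x + (1 - tvar) * h).
have FE g h : F g = F h <-> qclass J g = qclass J h.
  split=> [/eqP|/eqP]; rewrite qclass_eq => gh; apply/eqP; rewrite qclass_eq.
    by move: gh; rewrite opprD addrACA subrr add0r -mulrBr IJ.
  by rewrite opprD addrACA subrr add0r -mulrBr IJ.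
(* [F] is affine and the weights [tvar] and [1 - tvar] sum to 1, so the base point [x] is
   preserved. *)
have FM g h : alexander_op (F g) (F h) = F (tvar * g + (1 - tvar) * h).
  by rewrite /alexander_op /F -!qclassM -raddfD; congr qclass; ring.
have cP (u : X) : exists h, sval u = F h.
  by have := svalP u; rewrite {1}Orb_qclassE => -[h _ <-]; exists h.
(* By [FE] the class of [c u] modulo [J] does not depend on the choice. *)
have [c cE] := choice cP.
exists (fun u => qclass J (c u) : alexander (quotmod J)).
  move=> u v; apply: etrans (_ : qclass J (tvar * c u + (1 - tvar) * c v) = _).
    by apply/FE; rewrite -FM -!cE.
  by rewrite raddfD /= !qclassM.
have FP (q : quotmod J) :
    Orb (qclass I x : alexander (quotmod I)) (F (repr q)).
  by rewrite Orb_qclassE; exists (repr q).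
exists (fun q => exist _ (F (repr (q : quotmod J))) (FP q) : X) => u.
  apply: component_inj; rewrite /= [RHS]cE; apply/FE.
  by rewrite qclass_repr.
rewrite -[RHS](qclass_repr (u : quotmod J)); apply/FE.
by rewrite -cE.
Qed.

Section Presentation.
Variables (k : nat) (f : 'I_k -> laurent).
Let a := gcd_at1 f.
Let cl : laurent -> alexander (quotmod (ideal_gen f)) := qclass (ideal_gen f).

Lemma eval1_ideal_gen g : g \in ideal_gen f -> (a %| eval1 g)%Z.
Proof.
move=> /asboolP[c ->]; rewrite rmorph_sum /=; apply: rpred_sum => i _.
by rewrite rmorphM dvdz_mull // dvdz_biggcdn.
Qed.

(** A Bezout combination of the [f i] has value [a] at 1. Hence [a] is a multiple of [1 - tvar]
    modulo the ideal, and adding it does not leave an orbit. *)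
Lemma gcd_at1_ideal_gen :
  exists h, (1 - tvar) * h + a%:Z%:~R \in ideal_gen f.
Proof.
have [c cE] := biggcdn_bezout (fun i => eval1 (f i)).
have [ft ftP] := is_tilde_exists f.
exists (\sum_i (c i)%:~R * ft i); apply/asboolP; exists (fun i => (c i)%:~R).
rewrite /a /gcd_at1 cE rmorph_sum mulr_sumr -big_split /=.
by apply: eq_bigr => i _; rewrite [in RHS]ftP rmorphM mulrDr mulrCA.
Qed.

Lemma Orb_qclassP x g :
  Orb (cl x) (cl g) <-> (eval1 g = eval1 x %[mod a])%Z.
Proof.
rewrite Orb_qclassE; split=> [[h _ /eqP]|/eqP].
  rewrite qclass_eq => /eval1_ideal_gen.
  rewrite rmorphB rmorphD rmorphM /= eval1_1subt mul0r addr0 -eqz_mod_dvd.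
  by move/eqP.
rewrite eqz_mod_dvd => /dvdzP[m mE]; have [h hP] := gcd_at1_ideal_gen.
have [d dE] := eval1_decomp (g - x).
(* Here [g - x = (1 - tvar) * d + m * a], and modulo the ideal [m * a] equals
   [- m * (1 - tvar) * h]. *)
exists (d - m%:~R * h) => //; apply/eqP; rewrite qclass_eq.
have -> : x + (1 - tvar) * (d - m%:~R * h) - g =
    - m%:~R * ((1 - tvar) * h + a%:Z%:~R).
  have -> : g = x + (g - x) by rewrite addrC subrK.
  rewrite dE rmorphB /= mE rmorphM /=; ring.
exact: ideal_mulP.
Qed.

Lemma mul_1subt_ideal_gen (ft : 'I_k -> laurent) (h : laurent) :
  is_tilde f ft ->
  ((1 - tvar) * h \in ideal_gen f) =
  (h \in ideal_add (ideal_gen f) (tilde_ideal f ft)).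
Proof.
move=> ftP.
(* Once the last sum vanishes, [1 - tvar] times the combination of the [ft i] is a combination of
   the [f i]; both inclusions use this. *)
have sumE (c : 'I_k -> laurent) : \sum_i c i * f i =
    (1 - tvar) * (\sum_i c i * ft i) + \sum_i c i * (eval1 (f i))%:~R.
  rewrite mulr_sumr -big_split /=; apply: eq_bigr => i _.
  by rewrite [in LHS]ftP mulrDr mulrCA.
apply/idP/idP => [/asboolP[c cE]|/asboolP[u [v [uI /asboolP[c [c0 ->]] ->]]]].
  have [d dE] := choice (fun i => eval1_decomp (c i)).
  (* Evaluate [cE] at 1, where its left side vanishes. *)
  have c0 : \sum_i (eval1 (c i))%:~R * (eval1 (f i))%:~R = 0 :> laurent.
    transitivity ((eval1 ((1 - tvar) * h))%:~R : laurent).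
      rewrite cE !rmorph_sum /=; apply: eq_bigr => i _.
      by rewrite [eval1 (_ * _)]rmorphM rmorphM.
    by rewrite rmorphM /= eval1_1subt mul0r.
  apply/asboolP; exists (\sum_i d i * f i), (\sum_i (eval1 (c i))%:~R * ft i).
  split; [by apply/asboolP; exists d | | apply: mul_1subt_inj].
    by apply/asboolP; exists (fun i => (eval1 (c i))%:~R).
  have cftE : (1 - tvar) * (\sum_i (eval1 (c i))%:~R * ft i) =
      \sum_i (eval1 (c i))%:~R * f i by rewrite sumE c0 addr0.
  rewrite cE mulrDr cftE mulr_sumr -big_split /=; apply: eq_bigr => i _.
  by rewrite [in LHS]dE mulrDl mulrA.
rewrite mulrDr; apply: rpredD; first exact: ideal_mulP.
apply/asboolP; exists c.
by rewrite sumE c0 addr0.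
Qed.

End Presentation.

Theorem theorem1 (k : nat) (f : 'I_k -> laurent) :
  let M : quandleType := alexander (quotmod (ideal_gen f)) in
  let cl : laurent -> M := qclass (ideal_gen f) in
  let a := gcd_at1 f in
  let OrbZ : int -> set M := fun i => Orb (cl i%:~R) in
  [/\ [set: M] = \bigcup_(i in residues a) OrbZ i,
      trivIset (residues a) OrbZ,
      forall i : int, residues a i ->
        OrbZ i = [set cl g | g in [set g | (eval1 g = i %[mod a])%Z]] /\
        OrbZ i = [set x | exists (g : laurent) (j : int),
                   x = cl (i%:~R + (1 - tvar) * g + (a%:Z * j)%:~R)]
    & forall ft : 'I_k -> laurent, is_tilde f ft ->
      forall j : int, residues a j ->
        quandle_iso (component (cl j%:~R))
          (alexander (quotmod (ideal_add (ideal_gen f) (tilde_ideal f ft))))].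
Proof.
move=> M cl a OrbZ.
have OrbP i g : OrbZ i (cl g) <-> (eval1 g = i %[mod a])%Z.
  by rewrite -[i in (_ = i %[mod _])%Z]eval1_int; exact: Orb_qclassP.
have clP (x : M) : exists g, x = cl g by exact: qclass_onto.
split=> [|i j /residuesP ia /residuesP ja [x [+ +]]|i _|ft ftP j _].
- apply/seteqP; split=> // x _; have [g ->] := clP x.
  exists (eval1 g %% a)%Z; first by apply/residuesP; rewrite modz_mod.
  by apply/OrbP; rewrite modz_mod.
- have [g ->] := clP x => /OrbP gi /OrbP gj.
  by rewrite -ia -ja -gi -gj.
- split; apply/seteqP; split=> x /=.
  + by have [g ->] := clP x => /OrbP gi; exists g.
  + by case=> g gi <-; apply/OrbP.
  (* The multiple of [a] can be taken to be 0, since the orbit is already a coset of the multiples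
     of [1 - tvar]. *)
  + rewrite /OrbZ Orb_qclassE => -[h _ <-]; exists h, 0.
    by rewrite mulr0 addr0.
  + case=> g [j ->]; apply/OrbP.
    rewrite !rmorphD rmorphM /= !eval1_int eval1_1subt mul0r addr0.
    by rewrite mulrC addrC modzMDl.
- by apply: component_quotmod_iso => h; exact: mul_1subt_ideal_gen.
Qed.
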